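(* Let $k>0$ and let the ($1$-dimensional) $\mathcal F$-expectation $\mathcal E$ satisfy (A$_{ind}$) and (A$_{\rho(k)}$) on $\mathcal R^k$. If $\psi(t)\in l^2_{1\times1}(0,T)$ and $z\in\mathbf R^{1\times d}$ with $|z|\le k$ are such that $\psi(t)+zB_t$ is a continuous $\mathcal E$-supermartingale, then there exists a function $a(t)\in l^2_{1\times1}(0,T)$, which is continuous and increasing with $a(0)=0$, such that $$\mathcal E[\psi(T)+zB_T+a(T)|\mathcal F_t]=\psi(t)+zB_t+a(t),\quad\forall t\in[0,T].$$
   Context: $(B_t)_{t\ge0}$ is a $d$-dimensional standard Brownian motion on a complete probability space $(\Omega,\mathcal F,P)$, $(\mathcal F_t)$ its natural filtration augmented by the $P$-null sets, $T>0$; $\rho:[0,\infty)\to[0,\infty)$ is nondecreasing. (In)equalities between random variables hold a.s. $L^0(\mathcal F_t)$, $L^p(\mathcal F_t)$: real $\mathcal F_t$-measurable random variables, respectively arbitrary and $p$-integrable. $l^2_{1\times1}(0,T)$: deterministic measurable $\psi:[0,T]\to\mathbf R$ with $\int_0^T|\psi(t)|^2dt<\infty$. $\mathcal R^k=\{y+z(B_v-B_u):u,v\in[0,T],\,y\in\mathbf R,\,z\in\mathbf R^{1\times d},\,|z|\le k\}$. For $c\ge0$ and $\eta\in L^p(\mathcal F_T)$, $p>1$, $\mathcal E^c[\eta|\mathcal F_t]:=Y_t$, where $(Y,Z)$ is the solution of $Y_t=\eta+\int_t^Tc|Z_s|ds-\int_t^TZ_sdB_s$ with $Y$ continuous adapted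 and $Z$ progressively measurable, $E[(\int_0^T|Z_s|^2ds)^{p/2}]<\infty$. $\mathcal F$-expectation: a system of operators $\mathcal E[\cdot|\mathcal F_t]:L^0(\mathcal F_T)\to L^0(\mathcal F_t)$, $t\in[0,T]$, with (F1) $\mathcal E[\mathcal E[\xi|\mathcal F_t]|\mathcal F_s]=\mathcal E[\xi|\mathcal F_s]$ for $0\le s\le t\le T$; (F2) $\mathcal E[\xi|\mathcal F_t]=\xi$ if $\xi\in L^0(\mathcal F_t)$; (F3) $\mathcal E[\xi|\mathcal F_t]\ge\mathcal E[\eta|\mathcal F_t]$ if $\xi\ge\eta$; (F4) $\mathcal E[1_A\xi|\mathcal F_t]=1_A\mathcal E[\xi|\mathcal F_t]$ if $A\in\mathcal F_t$. $\mathcal E[\xi]:=\mathcal E[\xi|\mathcal F_0]$. (A$_{ind}$): $\mathcal E[z(B_s-B_t)|\mathcal F_t]=\mathcal E[z(B_s-B_t)]$ for all $z\in\mathbf R^{1\times d}$, $0\le t\le s\le T$. (A$_{\rho(k)}$) on $\mathcal R^k$: for all $\xi,\eta\in\mathcal R^k$ and $t\in[0,T]$, $\mathcal E[\xi|\mathcal F_t]-\mathcal E[\eta|\mathcal F_t]\le\mathcal E^{\rho(k)}[\xi-\eta|\mathcal F_t]$. A process $Y_t$ with $Y_t\in L^2(\mathcal F_t)$ for each $t\in[0,T]$ is an $\mathcal E$-supermartingale if $\mathcal E[Y_t|\mathcal F_s]\le Y_s$ for all $0\le s\le t\le T$. *)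

(* Defs.v *)
From HB Require Import structures.
From mathcomp Require Import all_boot all_order all_algebra.
From mathcomp Require Import all_classical all_reals all_analysis.
Set Implicit Arguments.
Unset Strict Implicit.
Unset Printing Implicit Defensive.
Import Order.TTheory GRing.Theory Num.Theory.
Import numFieldNormedType.Exports.
Local Open Scope classical_set_scope.
Local Open Scope ring_scope.

Section vectors.
Context (R : realType) (d : nat).

(* Euclidean norm: the library norm `|z| on matrices is the sup norm. *)
Definition enorm (z : 'rV[R]_d) : R := Num.sqrt (\sum_(i < d) (z ord0 i) ^+ 2).

Definition app (z : 'rV[R]_d) (b : 'cV[R]_d) : R := (z *m b) ord0 ord0.

End vectors.

(* Functions on [0, T] are represented by functions on R; their values outside
   [0, T] are never used. *)
Definition l2 (R : realType) (T : R) (psi : R -> R) : Prop :=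
  measurable_fun `[0, T] psi /\
  (\int[lebesgue_measure]_(t in `[0%R, T]) ((psi t) ^+ 2)%:E < +oo)%E.

Section brownian_motion.
Context (dO : measure_display) (Omega : measurableType dO) (R : realType)
  (P : probability Omega R) (d : nat).

Definition coord_events (X : Omega -> 'cV[R]_d) : set (set Omega) :=
  [set A | exists (i : 'I_d) (C : set R),
     measurable C /\ A = [set w | C (X w i ord0)]].

Definition past_events (B : R -> Omega -> 'cV[R]_d) (t : R) : set (set Omega) :=
  \bigcup_(r in `[0, t]) coord_events (B r).

Definition indep_sigma (G H : set (set Omega)) : Prop :=
  forall A D, <<s G >> A -> <<s H >> D -> P (A `&` D) = (P A * P D)%E.

Definition increment (B : R -> Omega -> 'cV[R]_d) (s t : R) (w : Omega) :=
  B t w - B s w.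

(* [bm_law] says that the increment has law N(0, (t - s) I_d).  The second
   parameter of [normal_prob] is the standard deviation; the case s = t is left
   out because [normal_prob _ 0] is not the Dirac mass. *)
Record brownian (B : R -> Omega -> 'cV[R]_d) : Prop := Brownian {
  bm_measurable : forall t i, 0 <= t ->
    measurable_fun setT (fun w => B t w i ord0) ;
  bm_start : {ae P, forall w, B 0 w = 0} ;
  bm_continuous : {ae P, forall w, forall i,
    {within `[0, +oo[, continuous (fun t => B t w i ord0)}} ;
  bm_law : forall s t (C : 'I_d -> set R), 0 <= s -> s < t ->
    (forall i, measurable (C i)) ->
    P [set w | forall i, C i (increment B s t w i ord0)] =
    (\prod_(i < d) normal_prob 0 (Num.sqrt (t - s)) (C i))%E ;
  bm_indep : forall s t, 0 <= s -> s < t ->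
    indep_sigma (past_events B s) (coord_events (increment B s t))
}.

(* Generators of the augmented natural filtration:
   F_t = <<s aug_gen B t >>. *)
Definition aug_gen (B : R -> Omega -> 'cV[R]_d) (t : R) : set (set Omega) :=
  past_events B t `|` [set N | P.-negligible N].

Definition L0 (B : R -> Omega -> 'cV[R]_d) (t : R) (X : Omega -> R) : Prop :=
  measurable_fun [set: g_sigma_algebraType (aug_gen B t)]
    (X : g_sigma_algebraType (aug_gen B t) -> R).

Definition Lp (B : R -> Omega -> 'cV[R]_d) (p t : R) (X : Omega -> R) : Prop :=
  L0 B t X /\ finite_norm P p%:E X.

End brownian_motion.

Section stochastic_integral.
Context (dO : measure_display) (Omega : measurableType dO) (R : realType)
  (P : probability Omega R) (d : nat) (B : R -> Omega -> 'cV[R]_d) (T : R).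

(* The simple integrand
     \sum_(i < si_size) si_coef i * 1_]si_time i, si_time i.+1]. *)
Record simple_integrand := SimpleIntegrand {
  si_size : nat ;
  si_time : nat -> R ;
  si_coef : nat -> Omega -> 'rV[R]_d
}.

Definition si_valid (H : simple_integrand) : Prop :=
  [/\ 0 <= si_time H 0,
      si_time H (si_size H) <= T,
      forall i, (i < si_size H)%N -> si_time H i <= si_time H i.+1,
      forall i (j : 'I_d), (i < si_size H)%N ->
        L0 P B (si_time H i) (fun w => si_coef H i w ord0 j) &
      exists K : R, forall i (j : 'I_d) w, (i < si_size H)%N ->
        `|si_coef H i w ord0 j| <= K].

Definition si_val (H : simple_integrand) (t : R) (w : Omega) : 'rV[R]_d :=
  \sum_(i < si_size H)
    (\1_(`]si_time H i, si_time H i.+1]) t : R) *: si_coef H i w.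

Definition si_int (H : simple_integrand) (t : R) (w : Omega) : R :=
  \sum_(i < si_size H)
    app (si_coef H i w)
      (B (Num.min t (si_time H i.+1)) w - B (Num.min t (si_time H i)) w).

Definition cvg_proba0 (X : nat -> Omega -> \bar R) : Prop :=
  forall e : R, 0 < e ->
    P [set w | (e%:E <= X n w)%E] @[n --> \oo] --> 0%E.

Definition continuous_adapted (Y : R -> Omega -> R) : Prop :=
  (forall t, t \in `[0, T] -> L0 P B t (Y t)) /\
  {ae P, forall w, {within `[0, T], continuous (Y ^~ w)}}.

Definition progressive (Z : R -> Omega -> 'rV[R]_d) : Prop :=
  forall t (i : 'I_d), t \in `[0, T] ->
    measurable_fun
      (`[0, t] `*` [set: g_sigma_algebraType (aug_gen P B t)])
      (fun x : R * g_sigma_algebraType (aug_gen P B t) => Z x.1 x.2 ord0 i).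

(* M is (a continuous version of) the Ito integral process
   M_t = \int_0^t Z_s dB_s on [0, T], for progressively measurable Z with
   \int_0^T |Z_s|^2 ds < oo a.s.: the limit in probability of the integrals of
   simple integrands that approximate Z. *)
Definition is_ito_integral (Z : R -> Omega -> 'rV[R]_d) (M : R -> Omega -> R)
    : Prop :=
  continuous_adapted M /\
  exists H : nat -> simple_integrand,
    [/\ forall n, si_valid (H n),
        cvg_proba0 (fun n w =>
          \int[lebesgue_measure]_(s in `[0%R, T])
            ((enorm (si_val (H n) s w - Z s w)) ^+ 2)%:E)%E &
        forall t, t \in `[0, T] ->
          cvg_proba0 (fun n w => `|si_int (H n) t w - M t w|%:E)].

(* (Y, Z) solves Y_t = eta + \int_t^T c |Z_s| ds - \int_t^T Z_s dB_s, with
   E[(\int_0^T |Z_s|^2 ds)^(p/2)] < oo. *)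
Definition bsde_solution (p c : R) (eta : Omega -> R)
    (Y : R -> Omega -> R) (Z : R -> Omega -> 'rV[R]_d) : Prop :=
  [/\ continuous_adapted Y,
      progressive Z,
      (\int[P]_w
         ((\int[lebesgue_measure]_(s in `[0%R, T]) ((enorm (Z s w)) ^+ 2)%:E)
            `^ (p / 2)) < +oo)%E &
      exists2 M, is_ito_integral Z M &
        forall t, t \in `[0, T] -> {ae P, forall w,
          Y t w = eta w
                  + \int[lebesgue_measure]_(s in `[t, T]) (c * enorm (Z s w))
                  - (M T w - M t w)}].

(* The process (E^c[eta | F_t])_{t in [0, T]} is Y.  By well-posedness of the
   equation there is exactly one such Y up to indistinguishability, and it does
   not depend on the exponent p with eta \in L^p. *)
Definition is_cexpectation (c : R) (eta : Omega -> R) (Y : R -> Omega -> R)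
    : Prop :=
  exists p Z, [/\ 1 < p, Lp P B p T eta & bsde_solution p c eta Y Z].

End stochastic_integral.

Section F_expectation.
Context (dO : measure_display) (Omega : measurableType dO) (R : realType)
  (P : probability Omega R) (d : nat) (B : R -> Omega -> 'cV[R]_d) (T : R).

(* [EE t xi] is E[xi | F_t].  Random variables are not quotiented by a.s.
   equality; [fe_mono] makes [EE t] compatible with it. *)
Record F_expectation (EE : R -> (Omega -> R) -> (Omega -> R)) : Prop :=
  FExpectation {
  fe_L0 : forall t xi, t \in `[0, T] -> L0 P B T xi -> L0 P B t (EE t xi) ;
  fe_tower : forall s t xi, 0 <= s -> s <= t -> t <= T -> L0 P B T xi ->
    {ae P, forall w, EE s (EE t xi) w = EE s xi w} ;
  fe_id : forall t xi, t \in `[0, T] -> L0 P B t xi ->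
    {ae P, forall w, EE t xi w = xi w} ;
  fe_mono : forall t xi eta, t \in `[0, T] -> L0 P B T xi -> L0 P B T eta ->
    {ae P, forall w, eta w <= xi w} ->
    {ae P, forall w, EE t eta w <= EE t xi w} ;
  fe_local : forall t xi (A : set Omega), t \in `[0, T] -> L0 P B T xi ->
    <<s aug_gen P B t >> A ->
    {ae P, forall w, EE t (fun w' => \1_A w' * xi w') w = \1_A w * EE t xi w}
}.

Definition A_ind (EE : R -> (Omega -> R) -> (Omega -> R)) : Prop :=
  forall (z : 'rV[R]_d) s t, 0 <= t -> t <= s -> s <= T ->
    {ae P, forall w,
      EE t (fun w' => app z (B s w' - B t w')) w =
      EE 0 (fun w' => app z (B s w' - B t w')) w}.

Definition Rk (k : R) : set (Omega -> R) :=
  [set xi | exists (u v y : R) (z : 'rV[R]_d),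
    [/\ u \in `[0, T], v \in `[0, T], enorm z <= k &
        xi = fun w => y + app z (B v w - B u w)]].

Definition A_dom (rho : R -> R) (k : R)
    (EE : R -> (Omega -> R) -> (Omega -> R)) : Prop :=
  forall xi eta Y, Rk k xi -> Rk k eta ->
    is_cexpectation P B T (rho k) (fun w => xi w - eta w) Y ->
    forall t, t \in `[0, T] ->
      {ae P, forall w, EE t xi w - EE t eta w <= Y t w}.

Definition E_supermartingale (EE : R -> (Omega -> R) -> (Omega -> R))
    (Y : R -> Omega -> R) : Prop :=
  (forall t, t \in `[0, T] -> Lp P B 2 t (Y t)) /\
  (forall s t, 0 <= s -> s <= t -> t <= T ->
    {ae P, forall w, EE s (Y t) w <= Y s w}).

End F_expectation.

(* Main.v *)
(* For increments of zB the equation defining the c-expectation is solved by a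
   deterministic Z, so (A_rho(k)) becomes explicit.  It yields
   E[zB_t | F_s] = zB_s + E[z(B_t - B_s) | F_s], invariance under deterministic
   translations, and |E[z(B_t - B_s) | F_s]| <= rho(k) |z| (t - s).  By (A_ind)
   and the triviality of F_0 the last conditional expectation is a constant,
   which by the tower property has the form g(t) - g(s) with g Lipschitz.  The
   supermartingale inequality then says that psi + g is nonincreasing, and
   a = psi(0) + g(0) - (psi + g) is the required function. *)
Require Import Defs.
From HB Require Import structures.
From mathcomp Require Import all_boot all_order all_algebra.
From mathcomp Require Import all_classical all_reals all_analysis.
From mathcomp Require Import measurable_realfun ring lra.
Set Implicit Arguments.
Unset Strict Implicit.
Unset Printing Implicit Defensive.
Import Order.TTheory GRing.Theory Num.Theory.
Import numFieldNormedType.Exports.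
Local Open Scope classical_set_scope.
Local Open Scope ring_scope.

(** * Linear forms and the Euclidean norm *)

Section euclidean.
Context (R : realType) (d : nat).
Implicit Types (z : 'rV[R]_d) (b : 'cV[R]_d).

Lemma appE z b : app z b = \sum_(j < d) z ord0 j * b j ord0.
Proof. by rewrite /app mxE. Qed.

Lemma appB z b c : app z (b - c) = app z b - app z c.
Proof. by rewrite /app mulmxBr !mxE. Qed.

Lemma appN z b : app (- z) b = - app z b.
Proof. by rewrite /app mulNmx mxE. Qed.

Lemma app0 b : app (0 : 'rV[R]_d) b = 0.
Proof. by rewrite /app mul0mx mxE. Qed.

Lemma enorm_ge0 z : 0 <= enorm z.
Proof. exact: sqrtr_ge0. Qed.

Lemma enormN z : enorm (- z) = enorm z.
Proof. by rewrite /enorm; under eq_bigr do rewrite mxE sqrrN. Qed.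

Lemma enorm0 : enorm (0 : 'rV[R]_d) = 0.
Proof.
rewrite /enorm big1 ?sqrtr0// => i _.
by rewrite mxE expr0n.
Qed.

Lemma enorm_indicZ (A : set R) s z : enorm (\1_A s *: z) = enorm z * \1_A s.
Proof.
rewrite indicE; case: (s \in A); first by rewrite scale1r mulr1.
by rewrite scale0r mulr0 enorm0.
Qed.

End euclidean.

(** * Step integrands and the c-expectation of an increment of zB *)

Section constant_integrand.
Context (dO : measure_display) (Omega : measurableType dO) (R : realType)
  (P : probability Omega R) (d : nat) (B : R -> Omega -> 'cV[R]_d) (T : R).
Hypothesis hB : brownian P B.

Lemma L0_brownian_coord t r (j : 'I_d) :
  r \in `[0, t] -> L0 P B t (fun w => B r w j ord0).
Proof.
move=> rt _ C mC; rewrite setTI; apply: sub_sigma_algebra; left.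
by exists r => //; exists j, C.
Qed.

Lemma L0_app t r z : r \in `[0, t] -> L0 P B t (fun w => app z (B r w)).
Proof.
move=> rt; rewrite /L0.
under eq_fun do rewrite appE.
apply: measurable_sum => j; apply: measurable_funM => //.
exact: L0_brownian_coord.
Qed.

Lemma L0D t X Y : L0 P B t X -> L0 P B t Y -> L0 P B t (fun w => X w + Y w).
Proof. exact: measurable_funD. Qed.

Lemma L0B t X Y : L0 P B t X -> L0 P B t Y -> L0 P B t (fun w => X w - Y w).
Proof. exact: measurable_funB. Qed.

Lemma L0_cst t (y : R) : L0 P B t (fun=> y).
Proof. exact: measurable_cst. Qed.

(** The map [Num.min t v] sends [[0, T]] continuously into [[0, +oo[], where almost all paths of [B]
    are continuous. Stopped paths are what step integrals are made of; for [v = T] they are the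
    original paths on [[0, T]]. *)
Lemma ae_continuous_app_min z v : 0 <= v ->
  {ae P, forall w, {within `[0, T], continuous (fun t => app z (B (Num.min t v) w))}}.
Proof.
move=> v0; apply: filterS (bm_continuous hB) => w cB.
rewrite (_ : (fun t => _) = fun t =>
    \sum_(j < d) z ord0 j * B (Num.min t v) w j ord0); last first.
  by apply/funext => t; rewrite appE.
apply/subspace_continuousP => x /=; rewrite in_itv/= => /andP[x0 xT].
apply: cvg_big => [|j _]; first exact: add_continuous.
apply: cvgM; first exact: cvg_cst.
have /subspace_continuousP/(_ (Num.min x v)) := cB j.
rewrite /= in_itv/= andbT le_min x0 v0 => /(_ isT).
apply: cvg_comp => A /=.
rewrite !nbhs_simpl /= /within /= => hA.
have cm : {for x, continuous (fun t : R => Num.min t v)}.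
  by apply: continuous_min => //; exact: cvg_cst.
move: (cm _ hA); rewrite /= !nbhs_simpl/=; apply: filterS => t /= h.
rewrite in_itv/= => /andP[t0 _]; apply: h.
by rewrite in_itv/= andbT le_min t0.
Qed.

(** The size is 1, so only the times of index 0 and 1 count. *)
Definition step_integrand (u v : R) (z : 'rV[R]_d) : simple_integrand Omega R d :=
  SimpleIntegrand 1 (fun i => if i is 0%N then u else v) (fun _ _ => z).

Lemma si_val_step u v z t w :
  si_val (step_integrand u v z) t w = \1_(`]u, v]) t *: z.
Proof. by rewrite /si_val big_ord1. Qed.

Lemma si_int_step u v z : si_int B (step_integrand u v z) =
  fun t w => app z (B (Num.min t v) w - B (Num.min t u) w).
Proof. by apply/funext => t; apply/funext => w; rewrite /si_int big_ord1. Qed.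

Lemma step_integrand_valid u v z :
  0 <= u -> u <= v -> v <= T -> si_valid P B T (step_integrand u v z).
Proof.
move=> u0 uv vT; split => //=; first by case.
  by move=> i j _; exact: L0_cst.
exists (\sum_(j < d) `|z ord0 j|) => i j w _.
rewrite (bigD1 j)//= lerDl.
by apply: sumr_ge0.
Qed.

Lemma cvg_proba0_eq0 (X : nat -> Omega -> \bar R) :
  (forall n w, X n w = 0%E) -> cvg_proba0 P X.
Proof.
move=> X0 e e0; rewrite (_ : (fun n => _) = fun=> 0%E); first exact: cvg_cst.
apply/funext => n; rewrite (_ : [set w | _] = set0) ?measure0//.
by apply/seteqP; split => // w /=; rewrite X0 lee_fin leNgt e0.
Qed.

Lemma continuous_adapted_step u v z : 0 <= u -> u <= v -> v <= T ->
  continuous_adapted P B T (si_int B (step_integrand u v z)).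
Proof.
move=> u0 uv vT; have v0 := le_trans u0 uv; split.
  move=> t; rewrite in_itv/= => /andP[t0 tT].
  rewrite si_int_step.
  under eq_fun do rewrite appB.
  by apply: L0B; apply: L0_app; rewrite in_itv/= le_min t0 ?v0 ?u0 ge_min lexx.
apply: filterS2 (ae_continuous_app_min z v0) (ae_continuous_app_min z u0).
move=> w cv cu.
rewrite si_int_step (_ : (fun t => _) = (fun t => app z (B (Num.min t v) w))
    \- (fun t => app z (B (Num.min t u) w))).
  exact: within_continuousB cv cu.
by apply/funext => t; rewrite /= appB.
Qed.

(** The integrand is itself simple, so the constant approximating sequence has zero error. *)
Lemma ito_integral_step u v z : 0 <= u -> u <= v -> v <= T ->
  is_ito_integral P B T (si_val (step_integrand u v z))
    (si_int B (step_integrand u v z)).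
Proof.
move=> u0 uv vT; split; first exact: continuous_adapted_step.
exists (fun=> step_integrand u v z); split.
- by move=> _; exact: step_integrand_valid.
- apply: cvg_proba0_eq0 => _ w.
  by under eq_integral do rewrite subrr enorm0 expr0n/=; rewrite integral0.
- by move=> t _; apply: cvg_proba0_eq0 => _ w; rewrite subrr normr0.
Qed.

Lemma progressive_step u v z : progressive P B T (si_val (step_integrand u v z)).
Proof.
move=> t i tT.
rewrite (_ : (fun x => _) = fun x : R * g_sigma_algebraType (aug_gen P B t) =>
   \1_(`]u, v]) x.1 * z ord0 i).
  apply: measurable_funTS; apply: measurable_funM => //.
  by apply: measurableT_comp => //; exact: measurable_indic.
by apply/funext => x; rewrite si_val_step mxE.
Qed.

(** The maxima cover three cases: the intersection is []u, v]] if [t <= u], [[t, v]] if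
    [u < t <= v], and empty if [t > v]. *)
Lemma lebesgue_measure_step (u v t : R) : t <= T -> u <= v -> v <= T ->
  lebesgue_measure (`[t, T] `&` `]u, v] : set R)
  = (Num.max 0 (v - Num.max t u))%:E.
Proof.
move=> tT uv vT; have [tu|ut] := leP t u.
  rewrite (_ : _ `&` _ = `]u, v]%classic); last first.
    apply/seteqP; split => x /=; rewrite !in_itv/=; first by case.
    move=> /andP[ux xv]; split; last by rewrite ux.
    by rewrite (le_trans tu (ltW ux)) (le_trans xv).
  rewrite lebesgue_measure_itv/= lte_fin max_r ?subr_ge0//.
  by case: ltgtP uv => // -> _; rewrite subrr.
rewrite (_ : _ `&` _ = `[t, v]%classic); last first.
  apply/seteqP; split => x /=; rewrite !in_itv/=.
    by move=> [/andP[-> _] /andP[_ ->]].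
  move=> /andP[tx xv]; split; first by rewrite tx (le_trans xv vT).
  by rewrite (lt_le_trans ut tx).
rewrite lebesgue_measure_itv/= lte_fin.
by case: ltP => tv; [rewrite max_r ?subr_ge0 1?ltW|rewrite max_l ?subr_le0].
Qed.

Lemma integral_step (u v t k : R) : t <= T -> u <= v -> v <= T -> 0 <= k ->
  (\int[lebesgue_measure]_(s in `[t, T]) (k * \1_(`]u, v]) s)%:E)%E
  = (k * Num.max 0 (v - Num.max t u))%:E.
Proof.
move=> tT uv vT k0.
transitivity (k%:E * \int[lebesgue_measure]_(s in `[t, T]) (\1_(`]u, v]) s)%:E)%E.
  apply: (@integralZl_indic _ _ _ lebesgue_measure _ _ (fun=> `]u, v]%classic)) => //.
  by move=> /lt_geF; rewrite k0.
rewrite EFinM; congr (_ * _)%E; rewrite integral_indic// setIC.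
exact: lebesgue_measure_step.
Qed.

(* For an increment of [zB], the driver [c * |Z|] is deterministic along the
   solution, with [Z = z 1_]u, v]]. *)
Lemma cexpectation_increment (c u v y : R) z :
  0 <= u -> u <= v -> v <= T -> 0 <= c ->
  finite_norm P 2%:E (fun w => y + app z (B v w - B u w)) ->
  is_cexpectation P B T c (fun w => y + app z (B v w - B u w))
    (fun t w => y + app z (B (Num.min t v) w - B (Num.min t u) w)
                + c * enorm z * Num.max 0 (v - Num.max t u)).
Proof.
move=> u0 uv vT c0 fin; have v0 := le_trans u0 uv; have T0 := le_trans v0 vT.
have uT := le_trans uv vT.
(* The exponent 2 fits the norm hypothesis and makes the power [p / 2] of the integrability
   condition equal to 1. *)
exists 2, (si_val (step_integrand u v z)); split; first by rewrite ltr1n.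
  split => //; apply: L0D; first exact: L0_cst.
  under eq_fun do rewrite appB.
  by apply: L0B; apply: L0_app; rewrite in_itv/= ?v0 ?u0.
have [ad cont] := @continuous_adapted_step u v z u0 uv vT.
rewrite si_int_step in ad cont.
split.
- split => [t tT|].
    apply: L0D; last exact: L0_cst.
    apply: L0D; first exact: L0_cst.
    exact: ad.
  apply: filterS cont => w cw.
  apply: within_continuousD.
    apply: within_continuousD.
      by apply: continuous_subspaceT => ?; exact: cvg_cst.
      exact: cw.
  apply: continuous_subspaceT => t.
  apply: cvgM; first exact: cvg_cst.
  apply: (@continuous_max R R (fun=> 0) (fun t => v - Num.max t u) t).
    exact: cvg_cst.
  apply: cvgB; first exact: cvg_cst.
  by apply: (@continuous_max R R id (fun=> u) t) => //; exact: cvg_cst.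
- exact: progressive_step.
- under eq_integral => w _.
    under eq_integral => s _.
      rewrite si_val_step enorm_indicZ exprMn indicE -natrX.
      (* An indicator is its own square, so the time integral of |Z|^2 is an explicit constant. *)
      rewrite (_ : (_ ^ 2)%N = (s \in `]u, v]%classic) :> nat); last by case: (_ \in _).
      rewrite -indicE.
      over.
    rewrite integral_step ?exprn_ge0 ?enorm_ge0// divff ?pnatr_eq0// poweRe1; last first.
      by rewrite lee_fin mulr_ge0 ?exprn_ge0 ?enorm_ge0// le_max lexx.
    over.
  rewrite integral_cst// [X in (_ * X)%E](_ : _ = 1%E) ?mule1 ?ltry//.
  exact: probability_setT.
- exists (si_int B (step_integrand u v z)); first exact: ito_integral_step.
  move=> t; rewrite in_itv/= => /andP[t0 tT]; apply: aeW => w.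
  rewrite /Rintegral.
  under eq_integral => s _ do rewrite si_val_step enorm_indicZ mulrA.
  rewrite integral_step ?mulr_ge0 ?enorm_ge0//=.
  (* At time [T] the stochastic integral is the whole increment, and the equation becomes an
     algebraic identity. *)
  rewrite !si_int_step (min_r vT) (min_r uT).
  by rewrite opprB addrA [in RHS]addrAC -[in RHS]addrA; ring.
Qed.

End constant_integrand.

(** * Almost sure statements and deterministic values *)

Section almost_everywhere.
Context (dO : measure_display) (Omega : measurableType dO) (R : realType)
  (P : probability Omega R).

Lemma ae_proper : ProperFilter (almost_everywhere P).
Proof.
apply: ae_properfilter_algebraOfSetsType.
by rewrite [ltRHS](@probability_setT _ _ _ P).
Qed.

(** Serves to turn an almost sure relation between deterministic quantities into a true one: a
    single outcome suffices. *)
Lemma ae_exists (Q : Omega -> Prop) : {ae P, forall w, Q w} -> exists w, Q w.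
Proof. by move=> /(@filter_ex _ _ ae_proper). Qed.

(* The rational cuts of [X] are a.s. deterministic and determine [X]. *)
Lemma ae_constant (X : Omega -> R) :
  (forall r, P.-negligible [set w | X w < r] \/
             P.-negligible (~` [set w | X w < r])) ->
  exists c, {ae P, forall w, X w = c}.
Proof.
move=> X01.
(* Enumerating the rationals merges countably many null sets into one; an index that codes no
   rational gets [True]. *)
have Xq : {ae P, forall w, forall n, if unpickle n is Some q then
    (X w < ratr (q : rat)) = `[< {ae P, forall w', X w' < ratr q} >] else True}.
  apply: ae_foralln => n; case: (unpickle n) => [q|]; last exact: aeW.
  have [lt0|ge0] := X01 (ratr q).
    have ge : {ae P, forall w, ratr q <= X w}.
      by apply: negligibleS lt0 => w /= /negP; rewrite -ltNge.
    apply: filterS (ge) => w qX; rewrite ltNge qX; apply/esym/asboolPn => lt.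
    have [w' [ge' lt']] := ae_exists (filterI ge lt).
    by rewrite ltNge ge' in lt'.
  have lt : {ae P, forall w, X w < ratr q} := ge0.
  by apply: filterS (lt) => w ->; apply/esym/asboolP.
have [w0 w0q] := ae_exists Xq.
exists (X w0); apply: filterS Xq => w wq.
have ww0 q : (X w < ratr q) = (X w0 < ratr q).
  by have := wq (pickle q); have := w0q (pickle q); rewrite pickleK => -> ->.
(* If the two values differed, a rational strictly between them would contradict [ww0]. *)
apply/eqP; rewrite eq_le !leNgt; apply/andP; split; apply/negP.
  move=> /rat_in_itvoo[q]; rewrite in_itv/= => /andP[q1 q2].
  by move: (ww0 q); rewrite q1 ltNge (ltW q2).
move=> /rat_in_itvoo[q]; rewrite in_itv/= => /andP[q1 q2].
by move: (ww0 q); rewrite q1 ltNge (ltW q2).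
Qed.

Lemma Lfun2P (f : Omega -> R) : f \in Lfun P 2%:E <->
  measurable_fun setT f /\ finite_norm P 2%:E f.
Proof.
rewrite inE; split.
  by move=> /andP[]; rewrite !inE.
by move=> [mf ff]; apply/andP; rewrite !inE.
Qed.

End almost_everywhere.

(** * Triviality of the augmented sigma-algebra at time 0 *)

Section zero_one.
Context (dO : measure_display) (Omega : measurableType dO) (R : realType)
  (P : probability Omega R) (d : nat) (B : R -> Omega -> 'cV[R]_d).
Hypothesis hB : brownian P B.

(** The sets that are negligible or have a negligible complement form a sigma-algebra. It contains
    the null sets, and also the events of [B 0], which are decided by whether [C] contains 0 since
    [B 0 = 0] a.s. *)
Lemma aug_gen0_trivial A : <<s aug_gen P B 0 >> A ->
  P.-negligible A \/ P.-negligible (~` A).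
Proof.
move: A; apply: smallest_sub; first split.
- by left; exact: negligible_set0.
- by move=> A; rewrite setTD setCK => -[]; [right|left].
(* One member with negligible complement settles the union; otherwise it is a countable union of
   negligible sets. *)
- move=> F F01; have [[n Fn]|noF] := pselect (exists n, P.-negligible (~` F n)).
    by right; apply: negligibleS Fn; apply: subsetC; exact: bigcup_sup.
  left; apply: negligible_bigcup => n; have [//|Fn] := F01 n.
  by exfalso; apply: noF; exists n.
move=> A [|]; last by left.
move=> [r]; rewrite /= in_itv/= -eq_le => /eqP <- [i [C [_ ->]]].
have [C0|C0] := pselect (C 0).
  right; apply: negligibleS (bm_start hB) => w /= nC B0; apply: nC.
  by rewrite B0 mxE.
left; apply: negligibleS (bm_start hB) => w /= nC B0; apply: C0.
by move: nC; rewrite B0 mxE.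
Qed.

Lemma L0_time0_constant X : L0 P B 0 X -> exists c, {ae P, forall w, X w = c}.
Proof.
move=> X0; apply: ae_constant => r; apply: aug_gen0_trivial.
have := X0 measurableT _ (measurable_itv `]-oo, r[).
by rewrite setTI; congr (<<s _ >> _); apply/seteqP; split => w;
  rewrite /= in_itv.
Qed.

End zero_one.

(** * The nonlinear expectation of zB *)

Section nonlinear_expectation.
Context (dO : measure_display) (Omega : measurableType dO) (R : realType)
  (P : probability Omega R) (d : nat) (B : R -> Omega -> 'cV[R]_d) (T : R)
  (rho : R -> R) (EE : R -> (Omega -> R) -> (Omega -> R)) (k : R) (z : 'rV[R]_d).
Hypothesis hB : brownian P B.
Hypothesis hT : 0 < T.
Hypothesis hrhok : 0 <= rho k.
Hypothesis hEE : F_expectation P B T EE.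
Hypothesis hind : A_ind P B T EE.
Hypothesis hdom : A_dom P B T rho k EE.
Hypothesis hz : enorm z <= k.
Hypothesis hfin : forall t, t \in `[0, T] ->
  finite_norm P 2%:E (fun w => app z (B t w)).

(** A version of zB_t that is literally an increment, as membership in [Rk] demands; [B 0] vanishes
    only almost surely. *)
Let X t w := app z (B t w - B 0 w).

Lemma EE_ae t xi eta : t \in `[0, T] -> L0 P B T xi -> L0 P B T eta ->
  {ae P, forall w, xi w = eta w} -> {ae P, forall w, EE t xi w = EE t eta w}.
Proof.
move=> tT Lxi Leta xieta.
have le : {ae P, forall w, xi w <= eta w} by apply: filterS xieta => w ->.
have ge : {ae P, forall w, eta w <= xi w} by apply: filterS xieta => w ->.
apply: filterS2 (fe_mono hEE tT Leta Lxi le) (fe_mono hEE tT Lxi Leta ge).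
by move=> w ? ?; apply/eqP; rewrite eq_le; apply/andP.
Qed.

Lemma L0_increment u v : u \in `[0, T] -> v \in `[0, T] ->
  L0 P B T (fun w => app z (B v w - B u w)).
Proof.
move=> uT vT; under eq_fun do rewrite appB.
by apply: L0B; exact: L0_app.
Qed.

Lemma measurable_app_brownian t : 0 <= t ->
  measurable_fun setT (fun w => app z (B t w)).
Proof.
move=> t0; under eq_fun do rewrite appE.
apply: measurable_sum => j; apply: measurable_funM => //.
exact: (bm_measurable hB).
Qed.

(** Both signs are needed because the domination bounds a difference from one side only; the summand
    0 is the constant [y] in the form used by [A_dom_le]. *)
Lemma finite_norm_increment u v : u \in `[0, T] -> v \in `[0, T] ->
  finite_norm P 2%:E (fun w => 0 + app z (B v w - B u w)) /\
  finite_norm P 2%:E (fun w => 0 + app (- z) (B v w - B u w)).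
Proof.
have p1 : (1 <= 2%:E :> \bar R)%E by rewrite lee_fin ler1n.
have L2 t : t \in `[0, T] -> (fun w => app z (B t w)) \in Lfun P 2%:E.
  move=> tT; apply/Lfun2P; split; last exact: hfin.
  by apply: measurable_app_brownian; move: tT; rewrite in_itv/= => /andP[].
have sub r s : r \in `[0, T] -> s \in `[0, T] ->
    finite_norm P 2%:E (fun w => app z (B s w) - app z (B r w)).
  move=> rT sT; suff /Lfun2P[] : ((fun w => app z (B s w)) -
    (fun w => app z (B r w))) \in Lfun P 2%:E by [].
  apply: (@Lfun_addr_closed _ _ _ P _ p1).2; first exact: L2.
  by apply: Lfun_oppr_closed; exact: L2.
move=> uT vT; split.
  by under eq_fun do rewrite add0r appB; exact: sub.
by under eq_fun do rewrite add0r appN appB opprB; exact: sub.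
Qed.

(** The domination with its c-expectation made explicit. The coefficient [z'] of the difference is
    free: it is taken to be 0, [z] or [- z] below. *)
Lemma A_dom_le xi eta (y : R) z' u v t : Rk B T k xi -> Rk B T k eta ->
  (forall w, xi w - eta w = y + app z' (B v w - B u w)) ->
  0 <= u -> u <= v -> v <= T ->
  finite_norm P 2%:E (fun w => y + app z' (B v w - B u w)) ->
  t \in `[0, T] ->
  {ae P, forall w, EE t xi w - EE t eta w <=
    y + app z' (B (Num.min t v) w - B (Num.min t u) w)
    + rho k * enorm z' * Num.max 0 (v - Num.max t u)}.
Proof.
move=> Rxi Reta xieta u0 uv vT fin tT.
pose Y t' w := y + app z' (B (Num.min t' v) w - B (Num.min t' u) w)
    + rho k * enorm z' * Num.max 0 (v - Num.max t' u).
apply: (@hdom xi eta Y Rxi Reta _ t tT).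
rewrite (_ : (fun w => _) = fun w => y + app z' (B v w - B u w)).
  exact: cexpectation_increment.
exact/funext.
Qed.

Let mem0T : 0 \in `[0, T].
Proof. by rewrite in_itv/= lexx ltW. Qed.

Lemma Rk_increment u v (y : R) : u \in `[0, T] -> v \in `[0, T] ->
  Rk B T k (fun w => y + app z (B v w - B u w)).
Proof. by move=> uT vT; exists u, v, y, z. Qed.

Lemma Rk_increment0 u v : u \in `[0, T] -> v \in `[0, T] ->
  Rk B T k (fun w => app z (B v w - B u w)).
Proof.
move=> uT vT; have := @Rk_increment u v 0 uT vT.
by under eq_fun do rewrite add0r.
Qed.

(** The two variables differ by the constant [y], whose c-expectation is [y]; domination in both
    orders gives equality. The constant is written with coefficient 0 on the degenerate interval
    from 0 to 0. *)
Lemma EE_translation u v (y : R) t : u \in `[0, T] -> v \in `[0, T] ->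
  t \in `[0, T] ->
  {ae P, forall w, EE t (fun w' => y + app z (B v w' - B u w')) w =
    y + EE t (fun w' => app z (B v w' - B u w')) w}.
Proof.
move=> uT vT tT.
have fin y' : finite_norm P 2%:E
    (fun w => y' + app (0 : 'rV[R]_d) (B 0 w - B 0 w)).
  under eq_fun do rewrite app0 addr0.
  by have /Lfun2P[] := Lfun_cst P y' 2.
have d1 w : y + app z (B v w - B u w) - app z (B v w - B u w) =
    y + app 0 (B 0 w - B 0 w) by rewrite app0; ring.
have d2 w : app z (B v w - B u w) - (y + app z (B v w - B u w)) =
    - y + app 0 (B 0 w - B 0 w) by rewrite app0; ring.
have R1 := Rk_increment y uT vT; have R2 := Rk_increment0 uT vT.
have le1 := A_dom_le R1 R2 d1 (lexx _) (lexx _) (ltW hT) (fin _) tT.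
have le2 := A_dom_le R2 R1 d2 (lexx _) (lexx _) (ltW hT) (fin _) tT.
apply: filterS2 le1 le2 => w; rewrite !app0 enorm0 mulr0 mul0r !addr0 => le1 le2.
by lra.
Qed.

(* The difference [X t - (zB_t - zB_s) = X s] has a c-expectation at time [s]
   equal to itself, for either sign. *)
Lemma EE_decomposition s t : 0 <= s -> s <= t -> t <= T ->
  {ae P, forall w, EE s (X t) w =
    X s w + EE s (fun w' => app z (B t w' - B s w')) w}.
Proof.
move=> s0 st tT; have sT := le_trans st tT; have t0 := le_trans s0 st.
have sI : s \in `[0, T] by rewrite in_itv/= s0.
have tI : t \in `[0, T] by rewrite in_itv/= t0.
have d1 w : X t w - app z (B t w - B s w) = 0 + app z (B s w - B 0 w).
  by rewrite /X !appB; ring.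
have d2 w : app z (B t w - B s w) - X t w = 0 + app (- z) (B s w - B 0 w).
  by rewrite /X !appN !appB; ring.
have R1 := Rk_increment0 mem0T tI; have R2 := Rk_increment0 sI tI.
have [f1 f2] := finite_norm_increment mem0T sI.
have le1 := A_dom_le R1 R2 d1 (lexx _) s0 sT f1 sI.
have le2 := A_dom_le R2 R1 d2 (lexx _) s0 sT f2 sI.
apply: filterS2 le1 le2 => w.
(* The increment from 0 to [s] is complete at time [s], so no drift remains and the two bounds
   coincide. *)
rewrite minxx (min_r s0) (max_l s0) subrr maxxx mulr0 appN /X.
by lra.
Qed.

Lemma EE_time0_constant : exists g : R -> R, forall t, t \in `[0, T] ->
  {ae P, forall w, EE 0 (X t) w = g t}.
Proof.
suff /choice[g gE] : forall t, exists c, t \in `[0, T] ->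
    {ae P, forall w, EE 0 (X t) w = c} by exists g.
(* Outside [[0, T]] the value 0 is a mere default. *)
move=> t; have [tT|_] := boolP (t \in `[0, T]); last by exists 0.
have [c Xc] : exists c, {ae P, forall w, EE 0 (X t) w = c}.
  by apply: (L0_time0_constant hB); apply: (fe_L0 hEE) => //; exact: L0_increment.
by exists c.
Qed.

Lemma EE_brownian : exists g : R -> R,
  (forall s t, 0 <= s -> s <= t -> t <= T ->
    {ae P, forall w, EE s (X t) w = X s w + (g t - g s)}) /\
  (forall s t, 0 <= s -> s <= t -> t <= T ->
    `|g t - g s| <= rho k * enorm z * (t - s)).
Proof.
have [g gE] := EE_time0_constant; exists g.
have h1 s t : 0 <= s -> s <= t -> t <= T ->
    {ae P, forall w, EE s (X t) w = X s w + (g t - g s)}.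
  move=> s0 st tT; have sT := le_trans st tT; have t0 := le_trans s0 st.
  have sI : s \in `[0, T] by rewrite in_itv/= s0.
  have tI : t \in `[0, T] by rewrite in_itv/= t0.
  have LI := L0_increment sI tI.
  (* By (A_ind) this constant [h] is also the conditional expectation of the increment given F_s. *)
  have [h Ih] := L0_time0_constant hB (fe_L0 hEE mem0T LI).
  have EX : {ae P, forall w, EE s (X t) w = h + X s w}.
    apply: filterS3 (EE_decomposition s0 st tT) (hind z s0 st tT) Ih.
    by move=> w -> -> ->; rewrite addrC.
  have LX : L0 P B T (fun w => h + X s w).
    by apply: L0D; [exact: L0_cst|exact: L0_increment].
  (* F_s is contained in F_T, so [EE s (X t)] is an admissible argument of [EE 0]. *)
  have LE : L0 P B T (EE s (X t)).
    move=> _ C mC; have := fe_L0 hEE sI (L0_increment mem0T tI) measurableT mC.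
    apply: sub_smallest2r; first exact: smallest_sigma_algebra.
    move=> A [[r]|]; last by right.
    rewrite /= in_itv/= => /andP[r0 rs] rA; left; exists r => //=.
    by rewrite in_itv/= r0 (le_trans rs).
  (* Applying [EE 0] to [EX], with the tower property and translation by [h], identifies [h] as
     [g t - g s]. *)
  have EX0 : {ae P, forall w, EE 0 (X t) w = h + EE 0 (X s) w}.
    apply: filterS3 (fe_tower hEE (lexx 0) s0 sT (L0_increment mem0T tI))
      (EE_ae mem0T LE LX EX) (EE_translation h mem0T sI mem0T).
    by move=> w e1 e2 e3; rewrite -[LHS]e1 e2.
  have [w gh] : exists w : Omega, g t = h + g s.
    apply: ae_exists; apply: filterS3 EX0 (gE s sI) (gE t tI).
    by move=> w -> -> ->.
  by apply: filterS EX => w' ->; rewrite gh addrK addrC.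
split => // s t s0 st tT; have sT := le_trans st tT; have t0 := le_trans s0 st.
have sI : s \in `[0, T] by rewrite in_itv/= s0.
have tI : t \in `[0, T] by rewrite in_itv/= t0.
have d1 w : X t w - X s w = 0 + app z (B t w - B s w).
  by rewrite /X !appB; ring.
have d2 w : X s w - X t w = 0 + app (- z) (B t w - B s w).
  by rewrite /X !appN !appB; ring.
have R1 := Rk_increment0 mem0T tI; have R2 := Rk_increment0 mem0T sI.
have [f1 f2] := finite_norm_increment sI tI.
have le1 := A_dom_le R1 R2 d1 s0 st tT f1 sI.
have le2 := A_dom_le R2 R1 d2 s0 st tT f2 sI.
(* At one common outcome both bounds hold and [X s] cancels. At time [s] the increment from [s] to
   [t] has not begun, so only the drift over length [t - s] is left. *)
have [w [[w1 w2] [w3 w4]]] := ae_exists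
  (filterI (filterI le1 le2) (filterI (h1 s t s0 st tT) (h1 s s s0 (lexx _) sT))).
move: w1 w2; rewrite -/(X t) -/(X s) w3 w4 subrr addr0.
rewrite minxx maxxx (min_l st) subrr appN enormN max_r ?subr_ge0//.
rewrite /app mulmx0 mxE => w1 w2.
by rewrite ler_norml; apply/andP; split; lra.
Qed.

End nonlinear_expectation.

(** * Lipschitz and continuous functions on [0, T] *)

Section real_functions.
Context (R : realType) (T : R).

Lemma lipschitz_within_continuous (g : R -> R) (K : R) :
  (forall s t, 0 <= s -> s <= t -> t <= T -> `|g t - g s| <= K * (t - s)) ->
  {within `[0, T], continuous g}.
Proof.
move=> gK; apply/subspace_continuousP => x /=; rewrite in_itv/= => /andP[x0 xT].
(* The sign of [K] is not prescribed, hence the absolute value; adding 1 below makes the divisor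
   positive. *)
have gdist t : 0 <= t -> t <= T -> `|g x - g t| <= `|K| * `|x - t|.
  move=> t0 tT; have [tx|xt] := leP t x.
    have xt0 : 0 <= x - t by rewrite subr_ge0.
    apply: le_trans (gK t x t0 tx xT) _.
    by rewrite (ger0_norm xt0) ler_wpM2r ?ler_norm.
  have tx0 : 0 <= t - x by rewrite subr_ge0 ltW.
  rewrite distrC (distrC x); apply: le_trans (gK x t x0 (ltW xt) tT) _.
  by rewrite (ger0_norm tx0) ler_wpM2r ?ler_norm.
apply/cvgrPdist_le => e e0.
rewrite near_withinE; near=> t => /=; rewrite in_itv/= => /andP[t0 tT].
apply: le_trans (gdist t t0 tT) _.
have K0 : 0 < `|K| + 1 by rewrite ltr_wpDl.
have tx : `|x - t| <= e / (`|K| + 1).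
  near: t; apply: (@cvgr_dist_le _ _ _ _ _ id x) => //; exact: divr_gt0.
rewrite (@le_trans _ _ ((`|K| + 1) * (e / (`|K| + 1))))//.
  by apply: ler_pM => //; rewrite lerDl.
by rewrite mulrC divfK// gt_eqF.
Unshelve. all: by end_near. Qed.

(** The square is continuous on a compact interval, hence integrable. *)
Lemma continuous_l2 (a : R -> R) : {within `[0, T], continuous a} -> l2 T a.
Proof.
move=> ca; split.
  by apply: subspace_continuous_measurable_fun => //; exact: measurable_itv.
have ca2 : {within `[0, T], continuous (fun t => a t ^+ 2)}.
  move=> x; apply: (@cvg_comp _ _ _ a (fun y => y ^+ 2) _ (nbhs (a x))).
    exact: ca.
  exact: exprn_continuous.
have /integrableP[_] := continuous_compact_integrable (@segment_compact _ 0 T) ca2.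
by under eq_integral do rewrite /= ger0_norm ?sqr_ge0//.
Qed.

End real_functions.

(** * From the drift [g] to the function [a] *)

Theorem lemmaA6 (dO : measure_display) (Omega : measurableType dO)
    (R : realType) (P : probability Omega R) (d : nat)
    (B : R -> Omega -> 'cV[R]_d) (T : R) (rho : R -> R)
    (EE : R -> (Omega -> R) -> (Omega -> R))
    (k : R) (psi : R -> R) (z : 'rV[R]_d)
    (hP : measure_is_complete P)
    (hd : (0 < d)%N)
    (hB : brownian P B)
    (hT : 0 < T)
    (hrho0 : forall x, 0 <= x -> 0 <= rho x)
    (hrho : forall x y, 0 <= x -> x <= y -> rho x <= rho y)
    (hk : 0 < k)
    (hEE : F_expectation P B T EE)
    (hind : A_ind P B T EE)
    (hdom : A_dom P B T rho k EE)
    (hpsi : l2 T psi)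
    (hz : enorm z <= k)
    (hcont : {ae P, forall w,
       {within `[0, T], continuous (fun t => psi t + app z (B t w))}})
    (hsuper : E_supermartingale P B T EE
       (fun t w => psi t + app z (B t w))) :
  exists a : R -> R,
    [/\ l2 T a,
        {within `[0, T], continuous a},
        {in `[0, T] &, {homo a : s t / s <= t}},
        a 0 = 0 &
        forall t, t \in `[0, T] -> {ae P, forall w,
          EE t (fun w' => psi T + app z (B T w') + a T) w =
          psi t + app z (B t w) + a t}].
Proof.
have k0 : 0 <= rho k by rewrite hrho0// ltW.
have [hL2 hle] := hsuper.
pose W t w := app z (B t w).
have mem0T : 0 \in `[0, T] by rewrite in_itv/= lexx ltW.
have memTT : T \in `[0, T] by rewrite in_itv/= lexx ltW.
have hfin t : t \in `[0, T] -> finite_norm P 2%:E (W t).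
  move=> tT; have [_ fin] := hL2 t tT.
  have p1 : (1 <= 2%:E :> \bar R)%E by rewrite lee_fin ler1n.
  suff /Lfun2P[] : W t \in Lfun P 2%:E by [].
  (* Square integrability of zB_t is inherited from the supermartingale by subtracting a
     constant. *)
  rewrite (_ : W t = cst (- psi t) + (fun w => psi t + W t w)); last first.
    by apply/funext => w; rewrite /cst/= addKr.
  apply: (@Lfun_addr_closed _ _ _ P _ p1).2; first exact: Lfun_cst.
  apply/Lfun2P; split => //; apply: measurable_funD => //.
  by apply: (measurable_app_brownian z hB); move: tT; rewrite in_itv/= => /andP[].
have [g [gE glip]] := EE_brownian hB hT k0 hEE hind hdom hz hfin.
pose X t w := app z (B t w - B 0 w).
have XW : {ae P, forall w, forall t, X t w = W t w}.
  by apply: filterS (bm_start hB) => w B0 t; rewrite /X B0 subr0.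
(* The formula for [X] carries over to zB itself, with a deterministic shift [y]. *)
have EEW s t (y : R) : 0 <= s -> s <= t -> t <= T ->
    {ae P, forall w, EE s (fun w' => y + W t w') w = y + W s w + (g t - g s)}.
  move=> s0 st tT; have t0 := le_trans s0 st; have sT := le_trans st tT.
  have sI : s \in `[0, T] by rewrite in_itv/= s0.
  have tI : t \in `[0, T] by rewrite in_itv/= t0.
  have LW : L0 P B T (fun w => y + W t w).
    by apply: L0D; [exact: L0_cst|exact: L0_app].
  have LX : L0 P B T (fun w => y + X t w).
    by apply: L0D; [exact: L0_cst|exact: L0_increment].
  have yWX : {ae P, forall w, y + W t w = y + X t w}.
    by apply: filterS XW => w ->.
  have e1 : {ae P, forall w, EE s (fun w' => y + W t w') w = y + EE s (X t) w}.
    apply: filterS2 (EE_ae hEE sI LW LX yWX)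
      (EE_translation hB hT k0 hdom hz y mem0T tI sI).
    by move=> w ->.
  apply: filterS3 e1 (gE s t s0 st tT) XW => w -> + XWw.
  by rewrite -/(X t) -/(X s w) XWw => ->; rewrite addrA.
(* Along one path where both [psi t + zB_t] and [zB_t] are continuous, [psi] is their difference. *)
have cpsi : {within `[0, T], continuous psi}.
  have [w [cw cB]] := ae_exists (filterI hcont (ae_continuous_app_min T hB z (ltW hT))).
  have := @within_continuousB _ _ _ _ _ _ cw cB.
  apply: subspace_eq_continuous => t.
  rewrite inE/= in_itv/= => /andP[_ tT].
  by rewrite /from_subspace/= !fctE (min_l tT) addrK.
have cg := lipschitz_within_continuous glip.
pose a t := psi 0 + g 0 - (psi t + g t).
have ca : {within `[0, T], continuous a}.
  apply: within_continuousB; last exact: within_continuousD.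
  by apply: continuous_subspaceT => ?; exact: cvg_cst.
exists a; split => //.
- exact: continuous_l2.
- move=> s t; rewrite !in_itv/= => /andP[s0 sT] /andP[t0 tT] st.
  (* With [y = psi t], the supermartingale inequality reads psi(t) + zB_s + g(t) - g(s) <= psi(s) +
     zB_s, and zB_s cancels. *)
  have [w h] : exists w : Omega, psi t + g t <= psi s + g s.
    apply: ae_exists.
    apply: filterS2 (hle s t s0 st tT) (EEW s t (psi t) s0 st tT) => w + e.
    by rewrite e /W => h; lra.
  by rewrite /a; lra.
- by rewrite /a subrr.
- move=> t; rewrite in_itv/= => /andP[t0 tT].
  (* The sum psi + g + a is constantly psi(0) + g(0), so psi(T) + a(T) + g(T) - g(t) equals psi(t) +
     a(t). *)
  apply: filterS (EEW t T (psi T + a T) t0 tT (lexx _)) => w.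
  rewrite (_ : (fun w' => psi T + a T + W T w') =
    (fun w' => psi T + app z (B T w') + a T)); last first.
    by apply/funext => w'; rewrite addrAC.
  by move=> ->; rewrite /a /W; ring.
Qed.
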